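(* Let $\mathcal{Q}$ be a combinatorially reducing system for a right ideal $I\lneqq\mathcal{A}=K[F]$ with respect to an exposure order $\prec$ on $F$. Then the minimal Schreier transversal $T_{I,\prec}$ is precisely the subset of words in $F$ that do not have any of $\{\mathrm{HT}_{\prec}(q):q\in\mathcal{Q}\}$ as a prefix.
   Context: $K$ is a field, $F$ is a free group with finite basis $S$ (elements are reduced words in $S\cup S^{-1}$; $e$ is the identity), and $\mathcal{A}=K[F]$. The support $\mathrm{supp}(f)$ of $f\in\mathcal{A}$ is the set of words with nonzero coefficient in $f$; $f$ is supported on $T\subseteq F$ if $\mathrm{supp}(f)\subseteq T$. $\mathrm{Sp}_K(T)$ is the $K$-span of $T$. An exposure order on $F$ is a well-order $\prec$ on $F$ such that $u\preceq v$ whenever $u$ is a prefix of $v$. For distinct subsets $A,B\subseteq F$: $A\prec_{\min}B$ if $\min(A\triangle B)\in A$ (a total order on subsets). For $0\neq f\in\mathcal{A}$, the head term $\mathrm{HT}(f)=\mathrm{HT}_\prec(f)$ is the $\prec$-maximal word in $\mathrm{supp}(f)$; $f$ is monic if the coefficient of $\mathrm{HT}(f)$ in $f$ is $1$. For $f\in\mathcal{A}\setminus K$, the head term tail $\mathrm{HTT}(f)\in S\cup S^{-1}$ is the last letter of the reduced word $\mathrm{HT}(f)$. A Schreier transversal for $I$ is a prefix-closed subset $T\subseteq F$ such that $\mathrm{Sp}_K(T)\cap I=\{0\}$ and every $I$-coset in $\mathcal{A}$ intersects $\mathrm{Sp}_K(T)$. The set of Schreier transversals for $I$ has a minimum with respect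 to $\prec_{\min}$, denoted $T_{I,\prec}$ (the minimal Schreier transversal). A prefix-neighbor of a prefix-closed set $T$ is a word not in $T$ all of whose proper prefixes lie in $T$; $\partial T$ is the set of prefix-neighbors of $T$. For a set $\mathcal{Q}$ of monic elements of $\mathcal{A}\setminus K$, let $T_{\mathcal{Q}}^{\mathrm{HT}}$ be the set of words in $F$ that do not have any $\mathrm{HT}(q)$, $q\in\mathcal{Q}$, as a prefix. $\mathcal{Q}$ is a combinatorially reducing system (CRS) with respect to $\prec$ if: (1) the head terms $(\mathrm{HT}(q))_{q\in\mathcal{Q}}$ are distinct; (2) for each $q\in\mathcal{Q}$, letting $b=\mathrm{HTT}(q)$, the element $qb^{-1}$ is a $K$-linear combination of elements $h\in\mathcal{Q}$ with $\mathrm{HTT}(h)=b^{-1}$; (3) each $q\in\mathcal{Q}$ is supported on $T_{\mathcal{Q}}^{\mathrm{HT}}\cup\partial T_{\mathcal{Q}}^{\mathrm{HT}}$. It is a CRS for $I$ if moreover it generates $I$ as a right ideal. *)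

(* Defs.v *)
From HB Require Import structures.
From mathcomp Require Import all_boot ssralg.
From mathcomp Require Import finmap.
From mathcomp.multinomials Require Import monalg.
From mathcomp Require Import boolp classical_sets wochoice.

Set Implicit Arguments.
Unset Strict Implicit.
Unset Printing Implicit Defensive.

Import GRing.Theory.
Local Open Scope fset_scope.
Local Open Scope ring_scope.
Local Open Scope classical_set_scope.

(** [(s, false)] is the letter [s] and [(s, true)] is the letter [s^-1]. *)
Definition letter (S : finType) : Type := (S * bool)%type.

HB.instance Definition _ (S : finType) := Finite.on (letter S).

Definition linv (S : finType) (x : letter S) : letter S := (x.1, ~~ x.2).

Definition reduced (S : finType) (w : seq (letter S)) : bool :=
  sorted (fun x y => y != linv x) w.

Record freegroup (S : finType) : predArgType := FreeGroup {
  word :> seq (letter S);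
  reduced_word : reduced word
}.

HB.instance Definition _ (S : finType) := [isSub for @word S].
HB.instance Definition _ (S : finType) := [Countable of freegroup S by <:].

Section FreeGroup.
Variable S : finType.
Implicit Types (x y : letter S) (u v w : seq (letter S)).

Definition lcons x w : seq (letter S) :=
  if w is y :: w' then if y == linv x then w' else x :: w else [:: x].

Definition wmul u v : seq (letter S) := foldr lcons v u.

Definition winv u : seq (letter S) := rev (map (@linv S) u).

Lemma linvK : involutive (@linv S).
Proof. by move=> [s b]; rewrite /linv /= negbK. Qed.

Lemma reduced_behead x w : reduced (x :: w) -> reduced w.
Proof. by rewrite /reduced /=; exact: path_sorted. Qed.

Lemma reduced_lcons x w : reduced w -> reduced (lcons x w).
Proof.
case: w => [|y w] //= rw; case: (boolP (y == linv x)) => [_|nyx].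
  exact: (reduced_behead rw).
by rewrite /reduced /= nyx.
Qed.

Lemma lconsE x w : reduced (x :: w) -> lcons x w = x :: w.
Proof. by case: w => [|y w] //=; rewrite /reduced /= => /andP[/negbTE->]. Qed.

Lemma lconsK x w : reduced w -> lcons (linv x) (lcons x w) = w.
Proof.
case: w => [|y w] /=; first by rewrite linvK eqxx.
move=> rw; case: (eqVneq y (linv x)) => [yx|nyx] /=; last by rewrite linvK eqxx.
by rewrite -yx lconsE.
Qed.

Lemma lconsVK x w : reduced w -> lcons x (lcons (linv x) w) = w.
Proof. by move=> rw; rewrite -{1}[x]linvK lconsK. Qed.

Lemma reduced_wmul u v : reduced v -> reduced (wmul u v).
Proof. by move=> rv; elim: u => //= x u; exact: reduced_lcons. Qed.

Lemma wmul_lcons x u v : reduced v -> wmul (lcons x u) v = lcons x (wmul u v).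
Proof.
move=> rv; case: u => [|y u] //=; case: eqVneq => [->|] //.
by rewrite lconsVK //; exact: reduced_wmul.
Qed.

Lemma wmulA u v w : reduced w -> wmul u (wmul v w) = wmul (wmul u v) w.
Proof. by move=> rw; elim: u => //= x u ->; rewrite wmul_lcons. Qed.

Lemma wmul0 u : reduced u -> wmul u [::] = u.
Proof.
elim: u => //= x u IHu rxu.
by rewrite IHu ?lconsE //; exact: reduced_behead rxu.
Qed.

Lemma winv_cons x u : winv (x :: u) = rcons (winv u) (linv x).
Proof. by rewrite /winv /= rev_cons. Qed.

Lemma winvK : involutive winv.
Proof. by move=> u; rewrite /winv map_rev revK (mapK linvK). Qed.

Lemma reduced_winv u : reduced u -> reduced (winv u).
Proof.
rewrite /reduced /winv rev_sorted sorted_map.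
rewrite (@eq_sorted _ _ (fun x y => y != linv x)) // => x y /=.
by rewrite linvK eq_sym.
Qed.

Lemma wmulKw u v : reduced v -> wmul (winv u) (wmul u v) = v.
Proof.
move=> rv; elim: u => //= x u IHu.
rewrite winv_cons /wmul foldr_rcons -/(wmul u v) lconsK //.
exact: reduced_wmul.
Qed.

Lemma wmulVw u : reduced u -> wmul (winv u) u = [::].
Proof. by move=> ru; rewrite -{2}(wmul0 ru) wmulKw. Qed.

Lemma wmulwV u : reduced u -> wmul u (winv u) = [::].
Proof. by move=> ru; rewrite -{1}[u]winvK wmulVw //; exact: reduced_winv. Qed.

Implicit Types f g h : freegroup S.

Definition fg1 : freegroup S := @FreeGroup S [::] isT.
Definition fgmul f g : freegroup S :=
  FreeGroup (reduced_wmul f (reduced_word g)).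
Definition fginv f : freegroup S := FreeGroup (reduced_winv (reduced_word f)).

Fact fgmulA : associative fgmul.
Proof. by move=> f g h; apply: val_inj; exact: wmulA (reduced_word h). Qed.
Fact fgmul1 : left_id fg1 fgmul.
Proof. by move=> f; exact: val_inj. Qed.
Fact fgmulg1 : right_id fg1 fgmul.
Proof. by move=> f; apply: val_inj; exact: wmul0 (reduced_word f). Qed.
Fact fgmulV : left_inverse fg1 fginv fgmul.
Proof. by move=> f; apply: val_inj; exact: wmulVw (reduced_word f). Qed.
Fact fgmulgV : right_inverse fg1 fginv fgmul.
Proof. by move=> f; apply: val_inj; exact: wmulwV (reduced_word f). Qed.

HB.instance Definition _ :=
  isGroup.Build (freegroup S) fgmulA fgmul1 fgmulg1 fgmulV fgmulgV.

Definition fgletter x : freegroup S := @FreeGroup S [:: x] isT.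

End FreeGroup.

Section Convolution.
Variables (K : fieldType) (G : groupType).
Implicit Types (f g h : {malg K[G]}) (a b : G) (c : K).

Definition gmul f g : {malg K[G]} :=
  \sum_(a <- msupp f) \sum_(b <- msupp g) << f@_a * g@_b *g (a * b)%g >>.

Lemma gmulw (d1 d2 : {fset G}) f g :
  (msupp f `<=` d1)%fset -> (msupp g `<=` d2)%fset ->
  gmul f g = \sum_(a <- d1) \sum_(b <- d2)
    << f@_a * g@_b *g (a * b)%g >>.
Proof.
move=> le_d1 le_d2; rewrite /gmul (big_fset_incl _ le_d1) /=.
  apply/eq_bigr=> a _; apply/big_fset_incl => // b _ /mcoeff_outdom ->.
  by rewrite mulr0 monalgU0.
move=> a _ /mcoeff_outdom fa.
by rewrite big1 => // b _; rewrite fa mul0r monalgU0.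
Qed.

Lemma gmul0g : left_zero 0 gmul.
Proof. by move=> g; rewrite /gmul msupp0 big_seq_fset0. Qed.

Lemma gmulg0 : right_zero 0 gmul.
Proof.
by move=> g; rewrite /gmul exchange_big msupp0 big_seq_fset0.
Qed.

Lemma gmulUU c1 c2 a b :
  gmul << c1 *g a >> << c2 *g b >> = << c1 * c2 *g (a * b)%g >>.
Proof. by rewrite (gmulw msuppU_le msuppU_le) !big_seq_fset1 !mcoeffUU. Qed.

Lemma gmulDl : left_distributive gmul +%R.
Proof.
move=> f g h.
rewrite (gmulw (fsubsetUl (msupp f) (msupp g)) (fsubset_refl (msupp h))).
rewrite (gmulw (fsubsetUr (msupp f) (msupp g)) (fsubset_refl (msupp h))).
rewrite (gmulw (msuppD_le f g) (fsubset_refl (msupp h))) -big_split /=.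
apply/eq_bigr=> a _; rewrite -big_split /=; apply/eq_bigr=> b _.
by rewrite mcoeffD mulrDl monalgUD.
Qed.

Lemma gmulDr : right_distributive gmul +%R.
Proof.
move=> f g h.
rewrite (gmulw (fsubset_refl (msupp f)) (fsubsetUl (msupp g) (msupp h))).
rewrite (gmulw (fsubset_refl (msupp f)) (fsubsetUr (msupp g) (msupp h))).
rewrite (gmulw (fsubset_refl (msupp f)) (msuppD_le g h)) -big_split /=.
apply/eq_bigr=> a _; rewrite -big_split /=; apply/eq_bigr=> b _.
by rewrite mcoeffD mulrDr monalgUD.
Qed.

Lemma gmul_suml (I : Type) (r : seq I) (F : I -> {malg K[G]}) g :
  gmul (\sum_(i <- r) F i) g = \sum_(i <- r) gmul (F i) g.
Proof. exact: (big_morph (gmul^~ g) (fun _ _ => gmulDl _ _ _) (gmul0g _)). Qed.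

Lemma gmul_sumr (I : Type) (r : seq I) (F : I -> {malg K[G]}) f :
  gmul f (\sum_(i <- r) F i) = \sum_(i <- r) gmul f (F i).
Proof. exact: (big_morph (gmul f) (fun _ _ => gmulDr _ _ _) (gmulg0 _)). Qed.

Fact gmulA : associative gmul.
Proof.
move=> f g h; rewrite [f]monalgE !gmul_suml; apply/eq_bigr=> a _.
rewrite [g]monalgE gmul_suml !gmul_sumr gmul_suml; apply/eq_bigr=> b _.
rewrite [h]monalgE !gmul_sumr; apply/eq_bigr=> d _.
by rewrite !gmulUU mulrA mulgA.
Qed.

Fact gmul1g : left_id << 1%g >> gmul.
Proof.
move=> f; rewrite [f]monalgE gmul_sumr; apply/eq_bigr=> a _.
by rewrite gmulUU mul1r mul1g.
Qed.

Fact gmulg1 : right_id << 1%g >> gmul.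
Proof.
move=> f; rewrite [f]monalgE gmul_suml; apply/eq_bigr=> a _.
by rewrite gmulUU mulr1 mulg1.
Qed.

Fact gone_neq0 : << 1%g >> != 0 :> {malg K[G]}.
Proof. by rewrite monalgU_eq0 oner_eq0. Qed.

Lemma scale_monalgU c1 c2 a :
  c1 *: << c2 *g a >> = << c1 * c2 *g a >> :> {malg K[G]}.
Proof. by apply/malgP=> b; rewrite mcoeffZ !mcoeffU mulrnAr. Qed.

Fact gscaleAl c f g : c *: gmul f g = gmul (c *: f) g.
Proof.
rewrite [f]monalgE gmul_suml !scaler_sumr gmul_suml; apply/eq_bigr=> a _.
rewrite [g]monalgE !gmul_sumr scaler_sumr; apply/eq_bigr=> b _.
by rewrite scale_monalgU !gmulUU scale_monalgU mulrA.
Qed.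

Fact gscaleAr c f g : c *: gmul f g = gmul f (c *: g).
Proof.
rewrite [f]monalgE !gmul_suml scaler_sumr; apply/eq_bigr=> a _.
rewrite [g]monalgE gmul_sumr !scaler_sumr gmul_sumr; apply/eq_bigr=> b _.
by rewrite scale_monalgU !gmulUU scale_monalgU mulrCA.
Qed.

End Convolution.

(** The ring structure that multinomials puts on [{malg K[G]}] requires that
    [x * y = 1] in [G] only for [x = y = 1], which excludes groups; hence this
    alias, with its own ring structure. *)
Definition galg (K : fieldType) (G : groupType) : Type := {malg K[G]}.

Section GroupAlgebra.
Variables (K : fieldType) (G : groupType).

HB.instance Definition _ := GRing.Lmodule.on (galg K G).
HB.instance Definition _ := GRing.Zmodule_isNzRing.Build (galg K G)
  (@gmulA K G) (@gmul1g K G) (@gmulg1 K G) (@gmulDl K G) (@gmulDr K G)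
  (@gone_neq0 K G).
HB.instance Definition _ :=
  GRing.Lmodule_isLalgebra.Build K (galg K G) (@gscaleAl K G).
HB.instance Definition _ :=
  GRing.Lalgebra_isAlgebra.Build K (galg K G) (@gscaleAr K G).

Definition gelt (a : G) : galg K G := << a >>.

End GroupAlgebra.

Arguments gelt K {G} a.

Definition lin_span (K : fieldType) (V : lmodType K) (X : set V) : set V :=
  [set f | exists (n : nat) (c : 'I_n -> K) (x : 'I_n -> V),
     (forall i, X (x i)) /\ f = \sum_(i < n) c i *: x i].

Definition right_ideal (R : nzRingType) (I : set R) : Prop :=
  [/\ I 0, forall f g, I f -> I g -> I (f + g) & forall f a, I f -> I (f * a)].

Section Exposure.
Variables (K : fieldType) (S : finType).
Local Notation F := (freegroup S).
Local Notation A := (galg K F).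

(** [le u v] stands for the reflexive order: [u] precedes or equals [v]. *)
Variable le : rel F.
Implicit Types (u v w : F) (f q : A) (T : set F) (I Q : set A).

Definition exposure_order : Prop :=
  well_order le /\ forall u v, prefix u v -> le u v.

Definition prec_min (X Y : set F) : Prop :=
  exists2 w, minimum_of le [in X `+` Y] w & X w.

Definition Sp T : set A := lin_span [set gelt K w | w in T].

Definition supported_on f T : Prop := forall w, w \in msupp f -> T w.

(** The default value [1] is only reached when [f = 0]. *)
Definition HT f : F := xget 1%g [set w | maximum_of le [in msupp f] w].

(** [None] is only reached when [HT f] is the identity, i.e. (for an exposure
    order) when [f] is a constant. *)
Definition HTT f : option (letter S) := ohead (rev (HT f)).

Definition monic f : Prop := f@_(HT f) = 1.

Definition constants : set A := [set c%:A | c in [set: K]].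

Definition prefix_closed T : Prop := forall u v, T v -> prefix u v -> T u.

Definition prefix_neighbors T : set F :=
  [set w | ~ T w /\ forall u, prefix u w -> u != w -> T u].

Definition schreier_transversal I T : Prop :=
  [/\ prefix_closed T, Sp T `&` I = [set 0] &
      forall f, ([set f + i | i in I] `&` Sp T) !=set0].

Definition minimal_schreier_transversal I T : Prop :=
  schreier_transversal I T /\
  forall T', schreier_transversal I T' -> T' <> T -> prec_min T T'.

Definition avoid_HT Q : set F :=
  [set w | forall q, Q q -> ~~ prefix (HT q) w].

Definition CRS Q : Prop :=
  [/\ (forall q, Q q -> ~ constants q /\ monic q),
      {in Q &, injective HT},
      (forall q b, Q q -> HTT q = Some b ->
         lin_span [set h | Q h /\ HTT h = Some (linv b)]
           (q * gelt K (fgletter b)^-1%g)) &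
      forall q, Q q ->
        supported_on q (avoid_HT Q `|` prefix_neighbors (avoid_HT Q))].

Definition CRS_for I Q : Prop := CRS Q /\ smallest (@right_ideal A) Q = I.

(** The minimum is unique, so the predicate does single out one set. *)
Lemma minimal_schreier_transversal_unique I T1 T2 :
  exposure_order ->
  minimal_schreier_transversal I T1 -> minimal_schreier_transversal I T2 ->
  T1 = T2.
Proof.
move=> [wo _] [s1 m1] [s2 m2]; apply: contrapT => ne.
have [u mu T1u] := m1 _ s2 (fun e => ne (esym e)).
have [v mv T2v] := m2 _ s1 ne.
have eX : T2 `+` T1 = T1 `+` T2 by rewrite setYC.
rewrite eX in mv.
have [|z [_ zu]] := wo [in T1 `+` T2]; first by exists u; case: mu.
have uv : u = v by rewrite -(zu _ mu) -(zu _ mv).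
subst v; have /set_mem[[_ nT2]|[_ nT1]] : u \in T1 `+` T2 by case: mu.
  exact: nT2.
exact: nT1.
Qed.

End Exposure.

(* Main.v *)
From HB Require Import structures.
Require Import Defs.
From mathcomp Require Import all_boot ssralg.
From mathcomp Require Import finmap.
From mathcomp.multinomials Require Import monalg.
From mathcomp Require Import boolp classical_sets wochoice.

(** Let T be the set of words avoiding the head terms. These head terms are
    exactly the prefix-neighbors of T, so rewriting each of them by the tail of
    its element of Q defines, by recursion along the well-order, a linear map
    [nf] that fixes Sp(T) and kills Q. The letter b acts on Sp(T) by
    v |-> nf (v b); by condition (2) of a CRS, the subspace spanned by the q
    with HTT(q) = b is mapped by b^-1 into the one attached to b^-1, so the
    actions of b and b^-1 are mutually inverse. Hence Sp(T) is a right
    K[F]-module, and f |-> 1 . f is a module morphism K[F] -> Sp(T) that kills I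
    and is the identity on Sp(T): T is a transversal. If the least word w of
    T (+) T' were in T' but not in T, it would be a neighbor of T, and
    w - nf w would be a nonzero element of I supported on T'. *)

Set Implicit Arguments.
Unset Strict Implicit.
Unset Printing Implicit Defensive.

Import GRing.Theory.
Local Open Scope ring_scope.
Local Open Scope classical_set_scope.

(** * Subspaces and linear spans *)

Section Subspaces.
Variables (K : fieldType) (V : lmodType K).
Implicit Types (X Y : set V).

Definition subspace X : Prop :=
  X 0 /\ forall c f g, X f -> X g -> X (c *: f + g).

Lemma subspaceZ X c f : subspace X -> X f -> X (c *: f).
Proof. by move=> [X0 XD] Xf; rewrite -[_ *: _]addr0; exact: XD. Qed.

Lemma subspaceD X f g : subspace X -> X f -> X g -> X (f + g).
Proof. by move=> [X0 XD] Xf Xg; rewrite -[f]scale1r; exact: XD. Qed.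

Lemma subspaceB X f g : subspace X -> X f -> X g -> X (f - g).
Proof.
by move=> sX Xf Xg; apply: subspaceD => //; rewrite -scaleN1r; exact: subspaceZ.
Qed.

Lemma subspace_sum X (J : eqType) (r : seq J) (P : pred J) (F : J -> V) :
  subspace X -> (forall i, i \in r -> P i -> X (F i)) ->
  X (\sum_(i <- r | P i) F i).
Proof.
move=> sX XF; rewrite big_seq_cond; apply: big_ind => [|f g|i /andP[]].
- by case: sX.
- exact: subspaceD.
- exact: XF.
Qed.

Lemma subspace_lin_span X : subspace (lin_span X).
Proof.
split=> [|c _ _ [m [d [x [Xx ->]]]] [n [e [y [Xy ->]]]]].
  by exists 0, (fun=> 0), (fun=> 0); split=> [[]//|]; rewrite big_ord0.
exists (m + n),
  (fun i => match split i with inl j => c * d j | inr j => e j end),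
  (fun i => match split i with inl j => x j | inr j => y j end).
split=> [i|]; first by case: (split i).
rewrite big_split_ord /= scaler_sumr; congr (_ + _); apply: eq_bigr => i _.
  by rewrite (unsplitK (inl i)) scalerA.
by rewrite (unsplitK (inr i)).
Qed.

Lemma lin_span_min X Y : subspace Y -> X `<=` Y -> lin_span X `<=` Y.
Proof.
move=> sY XY _ [n [c [x [Xx ->]]]]; apply: subspace_sum => // i _ _.
by apply: subspaceZ => //; exact: XY.
Qed.

Lemma sub_lin_span X : X `<=` lin_span X.
Proof.
move=> f Xf; exists 1, (fun=> 1), (fun=> f); split=> //.
by rewrite big_ord1 scale1r.
Qed.

End Subspaces.

Lemma subspace_preimage (K : fieldType) (V W : lmodType K) (L : {linear V -> W})
    (X : set W) :
  subspace X -> subspace (L @^-1` X).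
Proof.
move=> [X0 XD]; split=> [|c f g Xf Xg]; rewrite /preimage /= ?linear0 //.
by rewrite linearP; exact: XD.
Qed.

(** * Group algebras and linear extension of maps from the group *)

Section GroupAlgebra.
Variables (K : fieldType) (G : groupType).
Local Notation A := (galg K G).
Implicit Types (f g : A) (a b : G).

Lemma galgE f : f = \sum_(a <- msupp f) f@_a *: gelt K a.
Proof.
rewrite {1}[f]monalgE; apply: eq_bigr => a _.
by rewrite /gelt scale_monalgU mulr1.
Qed.

Lemma mcoeff_gelt a b : (gelt K a)@_b = (a == b)%:R.
Proof. exact: mcoeffU. Qed.

Lemma gelt1 : gelt K (1%g : G) = 1.
Proof. by []. Qed.

Lemma geltM a b : gelt K a * gelt K b = gelt K (a * b)%g.
Proof. by rewrite -[LHS]/(gmul _ _) /gelt gmulUU mulr1. Qed.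

Lemma galg_ind (X : set A) f :
  subspace X -> (forall a, a \in msupp f -> X (gelt K a)) -> X f.
Proof.
move=> sX Xa; rewrite [f]galgE; apply: subspace_sum => // a fa _.
by apply: subspaceZ => //; exact: Xa.
Qed.

Lemma mcoeff_mulr_gelt f a b : (f * gelt K a)@_(b * a)%g = f@_b.
Proof.
rewrite [f]galgE mulr_suml !raddf_sum /=; apply: eq_bigr => d _.
rewrite -scalerAl geltM !mcoeffZ !mcoeff_gelt; congr (_ * _%:R).
by congr nat_of_bool; apply/eqP/eqP => [/mulIg|->].
Qed.

Lemma msupp_mulr_gelt f a b :
  (b * a \in msupp (f * gelt K a))%g = (b \in msupp f).
Proof. by rewrite -!mcoeff_neq0 mcoeff_mulr_gelt. Qed.

Lemma right_ideal_subspace (I : set A) : right_ideal I -> subspace I.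
Proof.
move=> [I0 ID IM]; split=> // c f g If Ig; apply: ID => //.
by rewrite -[f]mulr1 scalerAr; exact: IM.
Qed.

Section LinearExtension.
Variables (V : lmodType K) (phi : G -> V).

Definition gext f : V := \sum_(a <- msupp f) f@_a *: phi a.

Lemma gextEw (d : {fset G}) f :
  (msupp f `<=` d)%fset -> gext f = \sum_(a <- d) f@_a *: phi a.
Proof.
move=> fd; apply: big_fset_incl => // a _ /mcoeff_outdom ->.
by rewrite scale0r.
Qed.

Fact gext_is_linear : linear gext.
Proof.
move=> c f g; pose d := (msupp f `|` msupp g)%fset.
have fd : (msupp f `<=` d)%fset by exact: fsubsetUl.
have gd : (msupp g `<=` d)%fset by exact: fsubsetUr.
have cfgd : (msupp (c *: f + g) `<=` d)%fset.
  apply: fsubset_trans (msuppD_le _ _) _; rewrite fsubUset gd andbT.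
  exact: fsubset_trans (msuppZ_le _ _) fd.
rewrite (gextEw fd) (gextEw gd) (gextEw cfgd) scaler_sumr -big_split /=.
by apply: eq_bigr => a _; rewrite mcoeffD mcoeffZ scalerDl scalerA.
Qed.

HB.instance Definition _ :=
  GRing.isLinear.Build K A V *:%R gext gext_is_linear.

Lemma gext_gelt a : gext (gelt K a) = phi a.
Proof.
by rewrite (gextEw msuppU_le) big_seq_fset1 mcoeff_gelt eqxx scale1r.
Qed.

End LinearExtension.

Lemma galg_const f : (msupp f `<=` [fset 1%g])%fset -> (f@_1%g)%:A = f.
Proof.
move=> f1; rewrite [RHS]galgE -[RHS]/(gext (@gelt K G) f).
by rewrite (gextEw _ f1) big_seq_fset1.
Qed.

End GroupAlgebra.

(** * Last letters and right multiplication by a letter *)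

Section FreeGroupLetters.
Variable S : finType.
Local Notation F := (freegroup S).
Implicit Types (u v w : F) (b c : letter S).

Definition last_letter (s : seq (letter S)) : option (letter S) :=
  ohead (rev s).

Lemma last_letter_rcons s b : last_letter (rcons s b) = Some b.
Proof. by rewrite /last_letter rev_rcons. Qed.

Lemma prefix_of_rcons (s t : seq (letter S)) b :
  prefix s (rcons t b) -> s = rcons t b \/ prefix s t.
Proof.
rewrite !prefixE -cats1; case: (leqP (size s) (size t)) => [st|ts].
  by rewrite takel_cat //; right.
by rewrite take_oversize ?size_cat ?addn1 // => /eqP<-; left.
Qed.

Lemma fgletterV b : fgletter (linv b) = (fgletter b)^-1%g.
Proof. exact: val_inj. Qed.

Lemma word_mul_rcons w b :
  reduced (rcons w b) -> word (w * fgletter b)%g = rcons w b.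
Proof. by move=> rwb; rewrite -[RHS](wmul0 rwb) /wmul foldr_rcons. Qed.

Lemma reduced_rcons (s : seq (letter S)) b :
  reduced (rcons s b) =
  reduced s && (if last_letter s is Some c then b != linv c else true).
Proof.
case/lastP: s => [|s c] //; rewrite last_letter_rcons.
by case: s => [|x s]; rewrite /reduced /= ?andbT // rcons_path last_rcons.
Qed.

Lemma fg_rconsP w :
  w = 1%g \/ exists u b, w = (u * fgletter b)%g /\ word w = rcons u b.
Proof.
case: w => w; case/lastP: w => [|w b] rw; first by left; exact: val_inj.
have rw' : reduced w by move: rw; rewrite reduced_rcons => /andP[].
right; exists (FreeGroup rw'), b; split=> //.
by apply: val_inj; rewrite -[RHS]/(word _) word_mul_rcons.
Qed.

Lemma fg_rcons_ind (P : F -> Prop) :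
  P 1%g ->
  (forall u b, word (u * fgletter b)%g = rcons u b ->
     P u -> P (u * fgletter b)%g) ->
  forall w, P w.
Proof.
move=> P1 PM w; move en : (size w) => n; elim: n w en => [|n IHn] w.
  by move/size0nil => w0; rewrite (_ : w = 1%g) //; exact: val_inj.
case: (fg_rconsP w) => [->//|[u [b [-> wub]]]].
by rewrite wub size_rcons => -[sun]; apply: PM => //; exact: IHn.
Qed.

Lemma mul_letterP w b :
  word (w * fgletter b)%g = rcons w b \/
  exists2 u, w = (u * fgletter (linv b))%g & word w = rcons u (linv b).
Proof.
case: (boolP (reduced (rcons w b))) => [rwb|].
  by left; exact: word_mul_rcons.
rewrite reduced_rcons reduced_word /=.
case: (fg_rconsP w) => [->//|[u [c [wE wu]]]].
by rewrite wu last_letter_rcons negbK => /eqP->; right; exists u; rewrite linvK.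
Qed.

End FreeGroupLetters.

(** * Well-orders *)

Section WellOrder.
Variables (T : eqType) (le : rel T).
Hypothesis wo : well_order le.

Definition strict (u v : T) : Prop := u != v /\ le u v.

Let wo_chain_predT : wo_chain le predT.
Proof. by move=> X _; exact: wo. Qed.

Lemma well_order_total : total le.
Proof. by move=> u v; exact: (wo_chainW wo_chain_predT). Qed.

Lemma well_order_anti : antisymmetric le.
Proof. by move=> u v; exact: (wo_chain_antisymmetric wo_chain_predT). Qed.

Lemma well_order_refl : reflexive le.
Proof. by move=> u; exact: (wo_chain_reflexive wo_chain_predT). Qed.

(** [well_order] speaks only of unique minima of nonempty sets. Whichever of the three elements is
    the minimum of [{u, v, w}], the claim follows at once or by antisymmetry. *)
Lemma well_order_trans : transitive le.
Proof.
move=> v u w uv vw.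
have [|z [[]]] := wo (A := [mem [:: u; v; w]]).
  by exists u; rewrite inE eqxx.
rewrite !inE => /or3P[] /eqP-> zmin _.
- by apply: zmin; rewrite !inE eqxx !orbT.
- rewrite (_ : u = v) //; apply: well_order_anti; rewrite uv /=.
  by apply: zmin; rewrite !inE eqxx.
- rewrite -(_ : v = w) //; apply: well_order_anti; rewrite vw /=.
  by apply: zmin; rewrite !inE eqxx !orbT.
Qed.

Lemma strict_wf : well_founded strict.
Proof.
move=> u; apply: contrapT => nu.
have [|z [[/set_mem nz zmin] _]] := wo (A := [in [set v | ~ Acc strict v]]).
  by exists u; exact/mem_set.
apply: nz; split=> v [nvz vz]; apply: contrapT => nv.
have zv : le z v by apply: zmin; exact/mem_set.
by move/eqP: nvz; apply; apply: well_order_anti; rewrite vz.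
Qed.

Lemma seq_maximum (s : seq T) :
  s <> [::] -> exists2 w, w \in s & {in s, forall u, le u w}.
Proof.
elim: s => // x s IHs _; case: s IHs => [_|y s IHs].
  by exists x => [|z]; rewrite inE // => /eqP->; exact: well_order_refl.
have [//|z zs zmax] := IHs; have [xz|zx] := orP (well_order_total x z).
  exists z => [|t]; first by rewrite inE zs orbT.
  by rewrite inE => /orP[/eqP->//|]; exact: zmax.
exists x => [|t]; first by rewrite inE eqxx.
rewrite inE => /orP[/eqP->|/zmax tz]; first exact: well_order_refl.
exact: well_order_trans tz zx.
Qed.

End WellOrder.

(** * Supports and head terms *)

Section Reduction.
Variables (K : fieldType) (S : finType) (le : rel (freegroup S)).
Local Notation F := (freegroup S).
Local Notation A := (galg K F).
Variable Q : set A.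
Hypothesis exposure : exposure_order le.
Hypothesis crs : CRS le Q.

Let wo : well_order le. Proof. by case: exposure. Qed.
Let le_prefix (u v : F) : prefix u v -> le u v.
Proof. by case: exposure => _; apply. Qed.

Local Notation T := (avoid_HT le Q).
Local Notation dT := (prefix_neighbors T).

Lemma subspace_supported_on (X : set F) :
  subspace [set f : A | supported_on f X].
Proof.
split=> [w|c f g fX gX w]; first by rewrite msupp0.
move/(fsubsetP (msuppD_le _ _)); rewrite in_fsetU => /orP[|/gX//].
by move/(fsubsetP (msuppZ_le _ _))/fX.
Qed.

Lemma supported_on_gelt (X : set F) w : X w -> supported_on (gelt K w) X.
Proof.
move=> Xw x; rewrite -mcoeff_neq0 mcoeff_gelt.
by case: (eqVneq w x) => [<-|]; rewrite ?eqxx.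
Qed.

Lemma SpE (X : set F) (f : A) : Sp X f <-> supported_on f X.
Proof.
split=> [|fX].
  apply: (lin_span_min (subspace_supported_on X)).
  by move=> _ [w Xw <-]; exact: supported_on_gelt.
apply: galg_ind => [|w /fX Xw]; first exact: subspace_lin_span.
by apply: sub_lin_span; exists w.
Qed.

Lemma HT_max (f : A) : f != 0 ->
  HT le f \in msupp f /\ forall w, w \in msupp f -> le w (HT le f).
Proof.
move=> f0; rewrite /HT; case: xgetP => [w _ [ws wmax]|noM]; first by split.
have [] := seq_maximum wo (s := msupp f).
  by move=> s0; move/eqP: f0; apply; rewrite [f]galgE s0 big_nil.
by move=> w ws wmax; case: (noM w); split.
Qed.

Lemma HT_coeff q : Q q -> q@_(HT le q) = 1.
Proof. by case: crs => + _ _ _ => /[apply] -[]. Qed.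

Lemma Q_neq0 q : Q q -> q != 0.
Proof.
move=> /HT_coeff; case: eqP => // ->; rewrite mcoeff0 => /eqP.
by rewrite eq_sym oner_eq0.
Qed.

Lemma HT_msupp q : Q q -> HT le q \in msupp q.
Proof. by move/Q_neq0/HT_max => []. Qed.

Lemma le_HT q w : Q q -> w \in msupp q -> le w (HT le q).
Proof. by move/Q_neq0/HT_max => [_]; apply. Qed.

(** The empty word is a prefix of every word, hence the least one. A head term [1] would therefore
    leave only [1] in the support and make [q] a constant. *)
Lemma HT_neq1 q : Q q -> HT le q <> 1%g.
Proof.
move=> Qq q1; case: crs => /(_ _ Qq)[+ _] _ _ _; apply; exists q@_1%g => //.
apply: galg_const; apply/fsubsetP => w /(le_HT Qq); rewrite q1 inE => w1.
apply/eqP.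
by apply: (well_order_anti wo); rewrite w1 (@le_prefix 1%g w) // prefix0s.
Qed.

(** * The set [T] of avoiding words and its neighbors *)

Lemma avoid_HT_prefix_closed : prefix_closed T.
Proof.
move=> u v Tv uv q Qq; apply: contra (Tv q Qq) => qu.
exact: prefix_trans qu uv.
Qed.

Lemma avoid_HT1 : T 1%g.
Proof.
move=> q Qq; apply/negP; rewrite prefixs0 => /eqP q1; apply: (HT_neq1 Qq).
exact: val_inj.
Qed.

Lemma HT_notin_avoid q : Q q -> ~ T (HT le q).
Proof. by move=> Qq /(_ q Qq); rewrite prefix_refl. Qed.

(** Being outside [T], a neighbor has a head term as prefix. A proper prefix would lie in [T], which
    contains no head term. *)
Lemma neighbor_HT w : dT w -> exists2 q, Q q & HT le q = w.
Proof.
move=> [nTw Tw]; apply: contrapT => nq; apply: nTw => q Qq.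
apply/negP => qw; apply: (HT_notin_avoid Qq); apply: Tw => //.
by apply/eqP => qE; apply: nq; exists q.
Qed.

Lemma neighbor_rcons (w u : F) b : dT w -> word w = rcons u b -> T u.
Proof.
move=> [_ Tw] wu; apply: Tw; first by rewrite wu prefix_rcons.
by apply/eqP => uw; move: (congr1 size wu); rewrite uw size_rcons => /n_Sn.
Qed.

Lemma closure_rcons (w u : F) b : (T `|` dT) w -> word w = rcons u b -> T u.
Proof.
move=> [Tw|/neighbor_rcons dw] wu; last exact: dw wu.
by apply: avoid_HT_prefix_closed Tw _; rewrite wu prefix_rcons.
Qed.

(** * The subspaces attached to a head term tail *)

Definition tail_span b : set A := lin_span [set h | Q h /\ HTT le h = Some b].

(** Condition (2) of a CRS gives this on the generators, and the elements satisfying it form a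
    subspace [R]. *)
Lemma tail_span_mul b m :
  tail_span b m -> tail_span (linv b) (m * gelt K (fgletter b)^-1%g).
Proof.
pose R := [set f : A | tail_span (linv b) (f * gelt K (fgletter b)^-1%g)].
suff: tail_span b `<=` R by apply.
have [M0 MD] := subspace_lin_span [set h | Q h /\ HTT le h = Some (linv b)].
apply: lin_span_min => [|q [Qq qb]]; last by case: crs => _ _ + _; apply.
split=> [|c f g Rf Rg]; first by rewrite /R /= mul0r.
by rewrite /R /= mulrDl -scalerAl; exact: MD.
Qed.

Lemma tail_span_supp b m : tail_span b m -> supported_on m (T `|` dT).
Proof.
apply: (lin_span_min (subspace_supported_on _)) => q [Qq _].
by case: crs => _ _ _; apply.
Qed.

(* Otherwise [w b^-1] would be a reduced word having the neighbor [w] as a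
   proper prefix, in the support of an element of [tail_span (linv b)]. *)
Lemma neighbor_tail b m w :
  tail_span b m -> w \in msupp m -> dT w -> last_letter w = Some b.
Proof.
move=> mb wm dw; have [w1 _] := dw.
have wm' : (w * (fgletter b)^-1)%g \in msupp (m * gelt K (fgletter b)^-1%g).
  by rewrite msupp_mulr_gelt.
have := tail_span_supp (tail_span_mul mb) wm'; rewrite -fgletterV.
case: (mul_letterP w (linv b)) => [wb /closure_rcons/(_ wb)//|[u _ ->]].
by rewrite linvK last_letter_rcons.
Qed.

(** If [b] cancels, the product is a prefix of [w]. Otherwise all its proper prefixes are prefixes
    of [w], so it is in [T] or a neighbor ending in [b]. *)
Lemma mul_letter_closure w b : T w ->
  (T `|` (dT `&` [set u | last_letter u = Some b])) (w * fgletter b)%g.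
Proof.
move=> Tw; case: (mul_letterP w b) => [wb|[u wE wu]]; last first.
  left; rewrite wE fgletterV mulgVK.
  by apply: avoid_HT_prefix_closed Tw _; rewrite wu prefix_rcons.
case: (pselect (T (w * fgletter b)%g)) => [|nT]; [by left|right; split].
  split=> // u; rewrite wb => /prefix_of_rcons[uwb|uw _].
    by case/eqP; apply: val_inj; exact: etrans uwb (esym wb).
  exact: avoid_HT_prefix_closed Tw uw.
by have := last_letter_rcons w b; rewrite -wb.
Qed.

Lemma supported_on_mul_letter b (f : A) : supported_on f T ->
  supported_on (f * gelt K (fgletter b))
    (T `|` (dT `&` [set u : F | last_letter u = Some b])).
Proof.
move=> fT w; rewrite -[w](mulgVK (fgletter b)) msupp_mulr_gelt.
by move=> /fT; exact: mul_letter_closure.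
Qed.

(** * Normal forms *)

Definition head_elt (w : F) : A := xget 0 [set q | Q q /\ HT le q = w].

Lemma head_eltE q : Q q -> head_elt (HT le q) = q.
Proof.
move=> Qq; rewrite /head_elt; case: xgetP => [p _ [Qp pq]|/(_ q) []//].
by case: crs => _ HTinj _ _; apply: HTinj pq; exact/mem_set.
Qed.

(** [pselect], unlike a boolean test, supplies the proof of [strict le u w] that the recursive call
    takes as an argument. *)
Definition nf_step (w : F) (rec : forall u, strict le u w -> A) : A :=
  if `[< T w >] then gelt K w else
  - \sum_(u <- msupp (head_elt w))
      (if pselect (strict le u w) is left uw then (head_elt w)@_u *: rec u uw
       else 0).

(* The normal form of [w] modulo the span of [Q], obtained by rewriting each
   head term by the tail of its element of [Q]; it is [0] (a junk value) on the
   words that are neither in [T] nor the head term of an element of [Q]. *)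
Definition nf_word : F -> A := Fix (strict_wf wo) (fun=> A) nf_step.

Lemma nf_wordE w :
  nf_word w = if `[< T w >] then gelt K w else
    - \sum_(u <- msupp (head_elt w))
      (if `[< strict le u w >] then (head_elt w)@_u *: nf_word u else 0).
Proof.
transitivity (nf_step (fun u (_ : strict le u w) => nf_word u)).
  apply: (Fix_eq (strict_wf wo) (fun=> A) nf_step) => {}w r1 r2 r12.
  rewrite /nf_step; case: asboolP => _; first by [].
  apply: (congr1 -%R); apply: eq_bigr => u _.
  by case: pselect => [uw|?] /=; [rewrite r12|].
rewrite /nf_step; case: asboolP => _; first by [].
apply: (congr1 -%R); apply: eq_bigr => u _.
by case: pselect => uw; case: asboolP.
Qed.

Lemma nf_word_id w : T w -> nf_word w = gelt K w.
Proof. by rewrite nf_wordE; case: asboolP. Qed.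

(** All other words of the support lie strictly below the head term, so the order test of the
    recursion reduces to [u != HT le q]. *)
Lemma nf_word_HT q : Q q ->
  nf_word (HT le q) = - \sum_(u <- msupp q | u != HT le q) q@_u *: nf_word u.
Proof.
move=> Qq; rewrite nf_wordE head_eltE //.
case: asboolP => [/HT_notin_avoid//|_].
apply: (congr1 -%R); rewrite [RHS]big_mkcond !big_seq.
apply: eq_bigr => u /(le_HT Qq) uq.
by case: asboolP => [[->]//|nuq]; case: ifP => // nu; case: nuq.
Qed.

(** The bound [le u w] serves the minimality argument, where [T] is compared with another
    transversal only below [w]. *)
Lemma nf_word_supp w :
  supported_on (nf_word w) [set u | T u /\ le u w].
Proof.
elim/(well_founded_ind (strict_wf wo)): w => w IHw; rewrite nf_wordE.
case: asboolP => [Tw|_].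
  by apply: supported_on_gelt; split=> //; exact: well_order_refl.
have sX := subspace_supported_on [set u | T u /\ le u w].
rewrite -sumrN; apply: (subspace_sum sX).
move=> u _ _; case: asboolP => [uw|_]; last first.
  by rewrite oppr0; case: sX.
rewrite -scaleNr; apply: (subspaceZ _ sX).
move=> x /(IHw _ uw)[Tx xu]; split=> //.
by apply: (well_order_trans wo xu); case: uw.
Qed.

Definition nf : A -> A := gext nf_word.

HB.instance Definition _ := GRing.Linear.on nf.

Lemma nf_Q q : Q q -> nf q = 0.
Proof.
move=> Qq; rewrite /nf /gext (bigD1_seq (HT le q)) ?HT_msupp ?fset_uniq //=.
by rewrite HT_coeff // scale1r nf_word_HT // addNr.
Qed.

Lemma nf_tail_span b m : tail_span b m -> nf m = 0.
Proof.
have s0 : subspace (nf @^-1` [set 0]).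
  apply: subspace_preimage; split=> // c _ _ -> ->.
  by rewrite scaler0 addr0.
by apply: (lin_span_min s0) => q [/nf_Q].
Qed.

Lemma nf_id f : supported_on f T -> nf f = f.
Proof.
move=> fT; rewrite [RHS]galgE; apply: eq_big_seq => w /fT Tw.
by rewrite nf_word_id.
Qed.

Lemma nf_supp f : supported_on (nf f) T.
Proof.
apply: (galg_ind (subspace_preimage nf (subspace_supported_on T))) => w _.
by rewrite /preimage /= /nf gext_gelt => u /nf_word_supp[].
Qed.

Lemma sub_tail q : Q q ->
  q - \sum_(u <- msupp q | u != HT le q) q@_u *: gelt K u = gelt K (HT le q).
Proof.
move=> Qq; apply/eqP; rewrite subr_eq; apply/eqP; rewrite {1}[q]galgE.
rewrite (bigD1_seq (HT le q)) ?HT_msupp ?fset_uniq //=.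
by rewrite HT_coeff // scale1r.
Qed.

(** Rewriting a neighbor ending in [b] uses only elements of [Q] with tail [b]: by [neighbor_tail],
    every neighbor in the support of such an element again ends in [b], so the induction stays
    inside [tail_span b]. *)
Lemma nf_word_sub b w :
  dT w -> last_letter w = Some b -> tail_span b (gelt K w - nf_word w).
Proof.
elim/(well_founded_ind (strict_wf wo)): w => w IHw dw wb.
have [q Qq qw] := neighbor_HT dw.
have Mq : tail_span b q by apply: sub_lin_span; split=> //; rewrite /HTT qw.
(* Here [w] is [q] minus its lower terms, and [nf_word w] is minus the normal form of those
   terms. *)
have -> : gelt K w - nf_word w =
    q - \sum_(u <- msupp q | u != HT le q) q@_u *: (gelt K u - nf_word u).
  rewrite (eq_bigr _ (fun u _ => scalerBr _ _ _)) sumrB opprB addrCA addrC.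
  by rewrite sub_tail // -qw nf_word_HT // opprK.
have sM : subspace (tail_span b) by exact: subspace_lin_span.
apply: subspaceB => //; apply: subspace_sum => // u uq uHT.
apply: subspaceZ => //; case: (tail_span_supp Mq uq) => [Tu|du].
  by rewrite nf_word_id // subrr; case: sM.
apply: IHw => //; first by split; rewrite -qw //; exact: le_HT.
exact: neighbor_tail Mq uq du.
Qed.

Lemma nf_sub b f :
  supported_on f (T `|` (dT `&` [set u | last_letter u = Some b])) ->
  tail_span b (f - nf f).
Proof.
have sM : subspace (tail_span b) by exact: subspace_lin_span.
move=> fE; rewrite [X in X - _]galgE -sumrB; apply: subspace_sum => // w wf _.
rewrite -scalerBr; apply: subspaceZ => //; case: (fE w wf) => [Tw|[dw wb]].
  by rewrite nf_word_id // subrr; case: sM.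
exact: nf_word_sub.
Qed.

(** * The action of letters on the span of [T] *)

Definition act (b : letter S) (v : A) : A := nf (v * gelt K (fgletter b)).

Fact act_is_linear b : linear (act b).
Proof. by move=> c f g; rewrite /act mulrDl -scalerAl linearP. Qed.

HB.instance Definition _ b :=
  GRing.isLinear.Build K A A *:%R (act b) (act_is_linear b).

(** The error [v b - act b v] lies in [tail_span b]. Multiplied by the inverse of [b], it lands in
    [tail_span (linv b)], which [nf] kills. *)
Lemma actK b v : supported_on v T -> act (linv b) (act b v) = v.
Proof.
move=> vT; have vb : tail_span b (v * gelt K (fgletter b) - act b v).
  by apply: nf_sub; exact: supported_on_mul_letter.
have /nf_tail_span := tail_span_mul vb; rewrite -fgletterV mulrBl linearB /=.
rewrite -mulrA geltM fgletterV mulgV gelt1 mulr1 nf_id // => /eqP.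
by rewrite subr_eq0 /act fgletterV => /eqP.
Qed.

Definition proj_word (w : F) : A := foldl (fun v b => act b v) 1 w.

Lemma proj_word_supp w : supported_on (proj_word w) T.
Proof.
case: (fg_rconsP w) => [->|[u [b [_ wu]]]].
  by rewrite /proj_word -gelt1; apply: supported_on_gelt; exact: avoid_HT1.
by rewrite /proj_word wu foldl_rcons; exact: nf_supp.
Qed.

(** When [b] cancels the last letter of [w], the two actions undo each other by [actK]. *)
Lemma proj_word_mul w b : proj_word (w * fgletter b)%g = act b (proj_word w).
Proof.
case: (mul_letterP w b) => [wb|[u wE wu]].
  by rewrite /proj_word wb foldl_rcons.
rewrite {1}wE fgletterV mulgVK [in RHS]/proj_word wu foldl_rcons.
by rewrite -[b in act b]linvK actK //; exact: proj_word_supp.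
Qed.

(** Proper prefixes of [w] lie in [T], so the letters act by plain concatenation until the last one,
    where [nf] is applied once. *)
Lemma proj_word_closure w : (T `|` dT) w -> proj_word w = nf_word w.
Proof.
elim/fg_rcons_ind: w => [_|u b wub IHu wT].
  by rewrite nf_word_id //; exact: avoid_HT1.
have Tu := closure_rcons wT wub.
rewrite proj_word_mul IHu; last by left.
by rewrite nf_word_id // /act geltM /nf gext_gelt.
Qed.

(** * The projection onto the span of [T] and its kernel *)

Definition proj : A -> A := gext proj_word.

HB.instance Definition _ := GRing.Linear.on proj.

Lemma proj_nf f : supported_on f (T `|` dT) -> proj f = nf f.
Proof. by move=> fE; apply: eq_big_seq => w /fE /proj_word_closure->. Qed.

Lemma proj_mul_letter f b : proj (f * gelt K (fgletter b)) = act b (proj f).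
Proof.
rewrite [f in LHS]galgE mulr_suml linear_sum [proj f]/gext linear_sum.
apply: eq_bigr => w _; rewrite -scalerAl !linearZ geltM /= /proj gext_gelt.
by rewrite proj_word_mul.
Qed.

(** Since [proj] turns multiplication by a letter into a linear action, its kernel is stable under
    letters, hence under words and their combinations. *)
Lemma proj_ker_right_ideal : right_ideal (proj @^-1` [set 0]).
Proof.
have sP : subspace (proj @^-1` [set 0]).
  apply: subspace_preimage; split=> // c _ _ -> ->.
  by rewrite scaler0 addr0.
split=> [|f g|f a f0]; [by case: sP|exact: subspaceD|].
pose R := [set a : A | proj (f * a) = 0].
suff: R a by [].
apply: galg_ind => [|w _].
  split=> [|c g h Rg Rh]; rewrite /R /=; first by rewrite mulr0 linear0.
  rewrite mulrDr -scalerAr; exact: (sP.2 c _ _ Rg Rh).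
elim/fg_rcons_ind: w => [|u b _ IHu]; rewrite /R /=.
  by rewrite gelt1 mulr1.
by rewrite -geltM mulrA proj_mul_letter IHu linear0.
Qed.

(** Condition (3) of a CRS places each [q] where [proj] agrees with [nf], and [nf] kills [Q]. *)
Lemma proj_ideal : smallest (@right_ideal A) Q `<=` proj @^-1` [set 0].
Proof.
apply: smallest_sub; first exact: proj_ker_right_ideal.
move=> q Qq; rewrite /preimage /= proj_nf ?nf_Q //.
by case: crs => _ _ _; apply.
Qed.

(** * The transversal property *)

Lemma tail_span_ideal b m : tail_span b m -> smallest (@right_ideal A) Q m.
Proof.
move=> mb I [/right_ideal_subspace sI QI].
by apply: (lin_span_min sI _ mb) => q [/QI].
Qed.

Lemma ideal_nf w : dT w -> smallest (@right_ideal A) Q (gelt K w - nf_word w).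
Proof.
move=> dw; case: (fg_rconsP w) => [w1|[u [b [_ wu]]]].
  by case: dw; rewrite w1 => -[]; exact: avoid_HT1.
apply: (@tail_span_ideal b); apply: nf_word_sub => //.
by rewrite wu last_letter_rcons.
Qed.

Lemma smallest_right_ideal : right_ideal (smallest (@right_ideal A) Q).
Proof.
split=> [I [[]]//|f g fJ gJ I IQ|f a fJ I IQ]; case: (IQ) => -[_ ID IM] _.
  by apply: ID; [exact: fJ|exact: gJ].
by apply: IM; exact: fJ.
Qed.

Lemma avoid_HT_transversal :
  schreier_transversal (smallest (@right_ideal A) Q) T.
Proof.
have J_ideal := smallest_right_ideal.
have sJ := right_ideal_subspace J_ideal.
have sT : subspace [set f : A | supported_on f T].
  exact: subspace_supported_on.
split; first exact: avoid_HT_prefix_closed.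
  apply/seteqP; split=> [f [/SpE fT /proj_ideal fJ]|_ ->]; last first.
    by split; [apply/SpE; case: sT|case: sJ].
  (* [proj f] is [0] because [f] is in the ideal, and is [f] because [f] is supported on [T]. *)
  by move: fJ; rewrite /preimage /= proj_nf ?nf_id // => w /fT; left.
(* The elements whose coset meets the span of [T] form a subspace, so it is enough to treat words,
   one letter at a time. *)
move=> f; pose R := [set f : A | exists2 i : A,
  smallest (@right_ideal A) Q i & supported_on (f + i) T].
suff [i iJ fiT] : R f by exists (f + i); split; [exists i|exact/SpE].
apply: galg_ind => [|w _].
  split=> [|c g h [i iJ giT] [j jJ hjT]].
    by exists 0; [case: sJ|rewrite addr0; case: sT].
  exists (c *: i + j); first by case: sJ => _; apply.
  by rewrite addrACA -scalerDr; case: sT => _; apply.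
elim/fg_rcons_ind: w => [|u b _ [i iJ uiT]].
  exists 0; first by case: sJ.
  by rewrite addr0; apply: supported_on_gelt; exact: avoid_HT1.
pose v : A := (gelt K u + i) * gelt K (fgletter b).
have vE : v = gelt K (u * fgletter b)%g + i * gelt K (fgletter b).
  by rewrite /v mulrDl geltM.
have vJ : smallest (@right_ideal A) Q (v - nf v).
  by apply: (@tail_span_ideal b); apply: nf_sub; exact: supported_on_mul_letter.
(* This correction turns the word [u b] into [nf v]. *)
exists (i * gelt K (fgletter b) - (v - nf v)).
  by apply: (subspaceB sJ _ vJ); case: J_ideal => _ _; apply.
by rewrite addrA -vE subKr; exact: nf_supp.
Qed.

(** * Minimality *)

Lemma avoid_HT_prec_min (T' : set F) :
  schreier_transversal (smallest (@right_ideal A) Q) T' -> T' <> T ->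
  prec_min le T T'.
Proof.
move=> [T'closed T'J _] T'T.
have [|w [[/set_mem wZ wmin] _]] := wo (A := [in T `+` T']).
  apply: contrapT => Z0; apply: T'T; apply/seteqP.
  by split=> w Tw; apply: contrapT => nTw; apply: Z0; exists w; apply/mem_set;
    [right|left].
(* Strictly below the least element [w] of their symmetric difference, [T] and [T'] agree. *)
have ltw u : le u w -> u != w -> T u <-> T' u.
  move=> uw nuw; split=> Tu; apply: contrapT => nTu; case/eqP: nuw;
    apply: (well_order_anti wo); rewrite uw; apply: wmin; apply/mem_set;
    by [left|right].
exists w; first by split=> //; exact/mem_set.
case: wZ => [[]//|[T'w nTw]].
(* Proper prefixes of [w] lie in [T'] by prefix-closure and precede [w], hence lie in [T]. *)
have dw : dT w.
  split=> // u uw nuw; apply/(ltw u) => //; first exact: le_prefix.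
  exact: T'closed uw.
have nfT : supported_on (gelt K w - nf_word w) T'.
  apply: (subspaceB (subspace_supported_on T')); first exact: supported_on_gelt.
  move=> u /nf_word_supp[Tu uw]; apply/ltw => //.
  by apply/eqP => uE; apply: nTw; rewrite -uE.
have : (Sp T' `&` smallest (@right_ideal A) Q) (gelt K w - nf_word w).
  by split; [exact/SpE|exact: ideal_nf].
rewrite T'J => /subr0_eq wE.
(* Now [w] equals its normal form, which is supported on [T], although [w] is not in [T]. *)
suff /nf_word_supp[] : w \in msupp (nf_word w) by [].
by rewrite -wE -mcoeff_neq0 mcoeff_gelt eqxx oner_eq0.
Qed.

End Reduction.

Theorem theorem1p5 (K : fieldType) (S : finType) (le : rel (freegroup S))
    (I Q : set (galg K (freegroup S))) :
  exposure_order le ->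
  right_ideal I -> I `<` [set: galg K (freegroup S)] ->
  CRS_for le I Q ->
  minimal_schreier_transversal le I (avoid_HT le Q).
Proof.
move=> exposure _ _ [crs <-]; split; first exact: avoid_HT_transversal.
by move=> T'; exact: avoid_HT_prec_min.
Qed.
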